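(* Let $q$ be a prime power, let $1\le a\le b$ be relatively prime integers, let $Y=\mathbb{P}(1,a,b)(\mathbb{F}_q)$, and let $d\ge1$. Put $$\mu_a=\min\{\lfloor (d-1)/a\rfloor,q-1\},\quad \mu_b=\min\{\lfloor (d-1)/b\rfloor,q-1\},\quad \ell=\max\left\{0,\min\left\{q-1,\left\lfloor\tfrac{d-1-a(q-1)}{b}\right\rfloor\right\}\right\}.$$ Then the dimension of the weighted projective Reed–Muller code $C_d$ is $$\dim_{\mathbb{F}_q}(C_d)=(\ell+1)\mu_a+\mu_b+1+\sum_{y=\ell+1}^{\mu_b}\left\lfloor\frac{d-1-by}{a}\right\rfloor+|H(d)|,$$ (an empty sum being $0$), where $$|H(d)|=\begin{cases}\mathrm{den}(d;a,b)&\text{if } d\le ab(q-1),\\ q-1+\mathbf{1}_{a\mid d}+\mathbf{1}_{b\mid d}&\text{if } d>ab(q-1).\end{cases}$$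
   Context: $\mathbb{P}(1,a,b)=(\mathbb{K}^3\setminus\{0\})/\mathbb{K}^*$ with $\mathbb{K}=\overline{\mathbb{F}_q}$ and $\lambda\in\mathbb{K}^*$ acting by $(x_0,x_1,x_2)\mapsto(\lambda x_0,\lambda^ax_1,\lambda^bx_2)$. Its $\mathbb{F}_q$-rational points are the classes having a representative in $\mathbb{F}_q^3$; there are $n=q^2+q+1$ of them. $S=\mathbb{F}_q[x_0,x_1,x_2]$ is graded by $\deg x_0=1,\deg x_1=a,\deg x_2=b$, with degree-$d$ part $S_d$. Fix for each point of $Y=\{P_1,\dots,P_n\}$ a representative in $\mathbb{F}_q^3$; the code $C_d$ is the image of $\mathrm{ev}_Y:S_d\to\mathbb{F}_q^n$, $f\mapsto(f(P_1),\dots,f(P_n))$ (its dimension does not depend on the choice of representatives). $\mathrm{den}(d;a,b)$ is the number of $(m_a,m_b)\in\mathbb{N}^2$ (with $0\in\mathbb{N}$) such that $d=m_aa+m_bb$. $\mathbf{1}_{a\mid d}$ equals $1$ if $a$ divides $d$ and $0$ otherwise; similarly $\mathbf{1}_{b\mid d}$. $H(d)=E_h(d)\cup[\{(0,d/b),(d/a,0)\}\cap\mathbb{Z}^2]$, where: if there is a lattice point $(x,y)$ with $ax+by=d$, $x>0$, $y>0$, let $(x',y')$ be the one with smallest $y$, set $t=\min\{q-2,\lfloor(d-by'-1)/(ab)\rfloor\}$ and $E_h(d)=\{(x'-ib,y'+ia):0\le i\le t\}$; otherwise $E_h(d)=\emptyset$. *)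

(* Defs.v *)
From HB Require Import structures.
From mathcomp Require Import all_boot all_order all_algebra all_field.
From mathcomp Require Import finmap mpoly.
From mathcomp Require Import boolp.

Set Implicit Arguments.
Unset Strict Implicit.
Unset Printing Implicit Defensive.

Import GRing.Theory.

Local Open Scope ring_scope.

Definition wt (a b : nat) : 'I_3 -> nat := tnth [tuple 1%N; a; b].

Section WeightedDegree.
Variables a b : nat.

Definition wmdeg (m : 'X_{1..3}) : nat := (\sum_(j < 3) m j * wt a b j)%N.

Fact wmdeg0 : wmdeg 0%MM = 0%N.
Proof. by rewrite /wmdeg big1 // => j _; rewrite mnm0E. Qed.

Fact wmdegD : {morph wmdeg : m1 m2 / (m1 + m2)%MM >-> (m1 + m2)%N}.
Proof.
move=> m1 m2; rewrite /wmdeg -big_split /=.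
by apply: eq_bigr => j _; rewrite mnmDE mulnDl.
Qed.

HB.instance Definition _ := isMeasure.Build 3 wmdeg wmdeg0 wmdegD.

End WeightedDegree.

Section WeightedPlane.
Variables (F : finFieldType) (K : closedFieldType) (iota : {rmorphism F -> K}).
Variables a b : nat.

Definition wscale (lam : K) (x : 'rV[K]_3) : 'rV[K]_3 :=
  \row_j (lam ^+ wt a b j * x 0 j).

(* A point of P(1,a,b) is an orbit, as a predicate on K^3. *)
Definition wpoint (Q : 'rV[K]_3 -> Prop) : Prop :=
  exists2 x, x != 0 &
    forall y, Q y <-> exists2 lam : K, lam != 0 & y = wscale lam x.

Definition rational (Q : 'rV[K]_3 -> Prop) : Prop :=
  exists v : 'rV[F]_3, Q (map_mx iota v).

(* P enumerates the F-rational points without repetition, each through a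
   representative with coordinates in F. *)
Definition wreps (n : nat) (P : 'I_n -> 'rV[F]_3) : Prop :=
  (forall i, P i != 0) /\
  (forall Q, wpoint Q -> rational Q -> exists! i, Q (map_mx iota (P i))).

End WeightedPlane.

Section Code.
Variables (F : finFieldType) (a b d n : nat) (P : 'I_n -> 'rV[F]_3).

Definition evY (f : {mpoly F[3]}) : 'rV[F]_n := \row_i f.@[fun j => P i 0 j].

Definition codeword (v : 'rV[F]_n) : Prop :=
  exists2 f : {mpoly F[3]}, f \is d.-homog for (wmdeg a b) & v = evY f.

(* The span turns the image of S_d into a {vspace _}; it adds no vector, by
   mem_wprm_code. *)
Definition wprm_code : {vspace 'rV[F]_n} :=
  <<[seq v <- enum 'rV[F]_n | `[< codeword v >]]>>%VS.

Lemma mem_wprm_code v : v \in wprm_code <-> codeword v.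
Proof.
split=> [|cv]; last first.
  apply: memv_span; rewrite mem_filter mem_enum andbT; exact/asboolP.
rewrite /wprm_code; set X := [seq _ <- _ | _] => vX.
have sX i : (i < size X)%N -> codeword X`_i.
  by move=> /(mem_nth 0); rewrite mem_filter => /andP[/asboolP].
rewrite (coord_span (X := in_tuple X) vX).
elim/big_rec: _ => [|i w _ [g hg ->]].
  by exists 0; [exact: rpred0 | apply/rowP => j; rewrite !mxE meval0].
have [f hf ->] := sX i (ltn_ord i).
exists (coord (in_tuple X) i v *: f + g); first by rewrite rpredD ?rpredZ.
by apply/rowP => j; rewrite !mxE mevalD mevalZ.
Qed.

End Code.

Section Counting.
Local Open Scope fset_scope.
Local Open Scope nat_scope.
Variables q a b d : nat.

(* For a, b > 0, every nonnegative solution of a x + b y = d satisfies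
   x, y <= d. *)

Definition den : nat :=
  #|[set m : 'I_d.+1 * 'I_d.+1 | d == m.1 * a + m.2 * b]|.

Definition interior : pred ('I_d.+1 * 'I_d.+1) :=
  [pred p : 'I_d.+1 * 'I_d.+1 |
    [&& 0 < p.1, 0 < p.2 & a * p.1 + b * p.2 == d]].

(* For i <= t one has i * b < x', so the subtraction x' - i * b never
   truncates. *)
Definition Eh : {fset nat * nat} :=
  if [pick p | interior p] is Some p0 then
    let: (x', y') := [arg min_(p < p0 | interior p) p.2] in
    let t := minn (q - 2) ((d - b * y' - 1) %/ (a * b)) in
    [fset (x' - i * b, y' + i * a) | i in iota 0 t.+1]
  else fset0.

Definition H : {fset nat * nat} :=
  Eh `|` (if b %| d then [fset (0, d %/ b)] else fset0)
     `|` (if a %| d then [fset (d %/ a, 0)] else fset0).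

Definition mu_a : nat := minn ((d - 1) %/ a) (q - 1).
Definition mu_b : nat := minn ((d - 1) %/ b) (q - 1).

(* The numerator d - 1 - a (q - 1) may be negative: this is integer floor
   division. *)
Definition ell_int : int :=
  Order.max 0%R
    (Order.min (q%:Z - 1)%R ((d%:Z - 1 - a%:Z * (q%:Z - 1)) %/ b%:Z)%Z%R).

Definition ell : nat := `|ell_int|.

End Counting.

(* Main.v *)
(* The evaluations of the monomials x0^(d - a m - b k) x1^m x2^k, for (m, k)
   ranging over the (m, k) in [0, q-1]^2 with a m + b k < d together with H(d),
   form a basis of the code.

   Spanning: at F_q-points a positive exponent only matters modulo q - 1. When
   x0 occurs, reduce the exponents of x1 and x2 into [0, q-1], the exponent of
   x0 being then determined modulo q - 1 and still positive. When it does not,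
   move along the line a m + b k = d by multiples of (q - 1)(-b, a).

   Independence: by homogeneity a combination vanishing on Y vanishes at every
   nonzero vector of F_q^3. The points (0, 1, 0) and (0, 0, 1) kill the
   coefficients on the axes. With t a - s b = 1, the points (0, z^s, z^t) turn
   the interior part of H(d) into z^N times a polynomial in z of degree at most
   q - 2 with q - 1 roots. Finally x0 = 1 leaves a polynomial in two variables
   of degree less than q in each, vanishing on F_q^2. *)

Require Import Defs.
From mathcomp Require Import all_boot all_order all_algebra all_field.
From mathcomp Require Import finmap mpoly.
From mathcomp Require Import zify ring.

(** * The set H(d) *)

Section LatticePoints.

Set Implicit Arguments.
Unset Strict Implicit.

Local Arguments iota : simpl never.

(** Since [a] divides [b (y - y')] and is prime to [b], it divides [y - y']; the quotient counts the
    steps [(-b, a)] along the line. *)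
Lemma coprime_line (a b x y x' y' : nat) :
    0 < a -> coprime a b -> y' <= y -> a * x + b * y = a * x' + b * y' ->
  exists2 i, x' = x + i * b & y = y' + i * a.
Proof.
move=> a_gt0 co_ab le_y eq_d.
have /dvdnP[i def_i] : a %| y - y'.
  rewrite -(Gauss_dvdr _ co_ab); apply/dvdnP; exists (x' - x); nia.
exists i; last lia.
have def_y : y = y' + i * a by lia.
apply/eqP; rewrite -(eqn_pmul2l a_gt0); apply/eqP; subst y; nia.
Qed.

(* Truncated subtraction: used only with i * b < x for all i < T. *)
Definition line (a b x y T : nat) : seq (nat * nat) :=
  [seq (x - i * b, y + i * a) | i <- iota 0 T].

Definition axis_points (a b d : nat) : seq (nat * nat) :=
  (if b %| d then [:: (0, d %/ b)] else [::]) ++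
  (if a %| d then [:: (d %/ a, 0)] else [::]).

Lemma size_axis_points a b d : size (axis_points a b d) = (a %| d) + (b %| d).
Proof. by rewrite size_cat addnC; do 2!case: ifP. Qed.

Lemma line_interior (a b d x y T : nat) :
    (forall i, i < T -> [/\ i * b < x, 0 < y & a * x + b * y = d]) ->
  {in line a b x y T, forall p, [/\ 0 < p.1, 0 < p.2 & a * p.1 + b * p.2 = d]}.
Proof.
move=> lineT p /mapP[i]; rewrite mem_iota add0n => /lineT[ltx y0 eqd] -> /=.
by split; nia.
Qed.

Variables a b d : nat.
Hypotheses (a_gt0 : 0 < a) (b_gt0 : 0 < b) (d_gt0 : 0 < d).

Lemma mem_axis (p : nat * nat) : (p \in axis_points a b d) =
  ((p.1 == 0) || (p.2 == 0)) && (a * p.1 + b * p.2 == d).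
Proof.
case: p => x y /=; rewrite mem_cat.
have -> : ((x, y) \in if b %| d then [:: (0, d %/ b)] else [::])
          = (x == 0) && (b * y == d).
  case: ifP => [|/dvdnP bd].
    case/dvdnP=> k ->; rewrite mulnK // inE xpair_eqE.
    by rewrite [b * y]mulnC eqn_pmul2r.
  apply/esym/negP => /andP[_ /eqP bd']; apply: bd; exists y; lia.
have -> : ((x, y) \in if a %| d then [:: (d %/ a, 0)] else [::])
          = (y == 0) && (a * x == d).
  case: ifP => [|/dvdnP ad].
    case/dvdnP=> k ->; rewrite mulnK // inE xpair_eqE andbC.
    by rewrite [a * x]mulnC eqn_pmul2r.
  apply/esym/negP => /andP[_ /eqP ad']; apply: ad; exists x; lia.
case: (x =P 0) => [->|_]; case: (y =P 0) => [->|_] /=;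
  rewrite ?muln0 ?addn0 ?orbb ?orbF //.
Qed.

Lemma uniq_line x y T : uniq (line a b x y T).
Proof.
rewrite map_inj_in_uniq ?iota_uniq // => i j _ _ [_ /eqP].
by rewrite eqn_add2l eqn_pmul2r // => /eqP.
Qed.

(** The two axis points can coincide only for [d = 0]. *)
Lemma uniq_axis : uniq (axis_points a b d).
Proof.
rewrite /axis_points; case: ifP => //= [/dvdnP[k d_k]|_]; case: ifP => //= _.
rewrite andbT inE xpair_eqE d_k mulnK //; apply/negP=> /andP[_ /eqP k0].
by move: d_gt0; rewrite d_k k0.
Qed.

Lemma uniq_line_axis x y T :
    (forall i, i < T -> i * b < x /\ 0 < y) ->
  uniq (line a b x y T ++ axis_points a b d).
Proof.
move=> posT; rewrite cat_uniq uniq_line uniq_axis andbT /=.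
apply/hasPn=> p; rewrite mem_axis => /andP[p0 _].
apply/mapP=> -[i]; rewrite mem_iota add0n => /posT[ltx y0] def_p.
by move: p0; rewrite def_p /=; lia.
Qed.

Variable q : nat.
Hypotheses (co_ab : coprime a b) (q_gt1 : 1 < q).

Lemma in_fset_line (x y T : nat) (p : nat * nat) :
  (p \in [fset (x - i * b, y + i * a)%N | i in iota 0 T]%fset) =
  (p \in line a b x y T).
Proof. by apply/imfsetP/mapP => -[i]; exists i. Qed.

(* The third clause says that the indices i of the interior lattice points form
   an initial segment, which H(d) truncates at q - 1. *)
Lemma H_decomposition :
  exists x y T,
  [/\ T <= q - 1,
      forall i, i < T -> [/\ i * b < x, 0 < y & a * x + b * y = d],
      forall x0 y0, 0 < x0 -> 0 < y0 -> a * x0 + b * y0 = d ->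
        exists i, [/\ x0 = x - i * b, y0 = y + i * a, i * b < x
                    & forall j, j < q - 1 -> j <= i -> j < T]
    & perm_eq (H q a b d) (line a b x y T ++ axis_points a b d)].
Proof.
have memH (E : {fset nat * nat}) p : (p \in (E
     `|` (if b %| d then [fset (0, d %/ b)] else fset0)
     `|` (if a %| d then [fset (d %/ a, 0)] else fset0))%fset)
     = (p \in E) || (p \in axis_points a b d).
  rewrite !in_fsetU -orbA mem_cat; congr (_ || (_ || _)).
    by case: ifP => _; rewrite ?inE.
  by case: ifP => _; rewrite ?inE.
have lt_d x y : 0 < x -> 0 < y -> a * x + b * y = d -> x < d.+1 /\ y < d.+1.
  by move=> *; nia.
rewrite /H /Eh; case: pickP => [p0 int0|noint]; last first.
  (* Without interior lattice points the segment is empty and its starting point arbitrary. *)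
  exists 0, 0, 0; split=> //.
    move=> x y x0 y0 eqd; have [ltx lty] := lt_d _ _ x0 y0 eqd.
    by move: (noint (Ordinal ltx, Ordinal lty)); rewrite /interior /= x0 y0 eqd eqxx.
  apply: uniq_perm; rewrite ?fset_uniq ?uniq_line_axis //.
  by move=> p; rewrite memH in_fset0.
case: arg_minnP => //= -[[x ltx] [y lty]] /= /and3P[/= x0 y0 /eqP eqd] min_y.
set t := minn _ _.
(* As [d - b y = a x], the floor bounding [t] is the last index [i] with [i b < x]. *)
have leN i : (i <= (d - b * y - 1) %/ (a * b)) = (i * b < x).
  rewrite leq_divRL ?muln_gt0 ?a_gt0 //.
  have -> : d - b * y - 1 = a * x - 1 by rewrite -eqd addnK.
  by rewrite -(ltn_pmul2l a_gt0) leq_subRL ?muln_gt0 ?a_gt0 // add1n mulnCA.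
have ltT i : (i < t.+1) = (i <= q - 2) && (i * b < x) by rewrite ltnS leq_min leN.
exists x, y, t.+1; split.
- rewrite /t; lia.
- by move=> i; rewrite ltT => /andP[].
- move=> u v u0 v0 equv; have [ltu ltv] := lt_d _ _ u0 v0 equv.
  have le_v : y <= v.
    by apply: (min_y (Ordinal ltu, Ordinal ltv)); rewrite /interior /= u0 v0 equv eqxx.
  have [|i def_x def_v] := @coprime_line a b u v x y a_gt0 co_ab le_v.
    by rewrite equv.
  have lti : i * b < x by lia.
  exists i; split=> //; first lia.
  move=> j ltj leji; rewrite ltT; apply/andP; split; first lia.
  by apply: leq_ltn_trans lti; rewrite leq_mul2r leji orbT.
apply: uniq_perm; rewrite ?fset_uniq ?uniq_line_axis //.
  by move=> i; rewrite ltT => /andP[].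
by move=> p; rewrite memH [RHS]mem_cat in_fset_line.
Qed.

(** If [u b] is 1 modulo [a], then any [y] congruent to [u d] makes [d - b y] divisible by [a];
    taking [1 <= y <= a] gives [b y <= a b < d], hence [x > 0]. *)
Lemma lattice_point_low :
  a * b < d -> exists x y, [/\ 0 < x, 0 < y, y <= a & a * x + b * y = d].
Proof.
move=> lt_ab.
have [[u v] /= uv1] : exists u, u.1 * b - u.2 * a = 1.
  by apply/coprimeP; rewrite // coprime_sym.
(* The shifts by [a - 1] and by 1 place the residue in [[1, a]] instead of [[0, a - 1]]. *)
pose y := ((u * d + a - 1) %% a).+1.
have y_le : y <= a by rewrite ltn_mod.
pose k := (u * d + a - 1) %/ a.
have def_k : u * d + a = k * a + y.
  by have := divn_eq (u * d + a - 1) a; rewrite -/k /y; lia.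
have uvd : b * (u * d) = d + v * d * a by nia.
have lt_by : b * y < d by nia.
have /dvdnP[x def_x] : a %| d - b * y.
  apply/dvdnP; exists (b * k - v * d - b); nia.
exists x, y; split=> //; nia.
Qed.

(** For [d <= a b (q - 1)] every interior index is below [q - 1], so truncation loses nothing and
    [H] consists of all nonnegative solutions. For larger [d] there are at least [q - 1] interior
    points, and truncation keeps exactly [q - 1]. *)
Lemma card_H : #|` H q a b d| =
  if d <= a * b * (q - 1) then den a b d else q - 1 + (a %| d) + (b %| d).
Proof.
have [x [y [T [leT ptT intT eqH]]]] := H_decomposition.
have memH p : (p \in H q a b d) = (p \in line a b x y T ++ axis_points a b d).
  exact: (perm_mem eqH).
case: leqP => [le_d|lt_d].
  pose f (m : 'I_d.+1 * 'I_d.+1) := (val m.1, val m.2).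
  have f_inj : injective f.
    by move=> [u v] [u' v'] [/val_inj -> /val_inj ->].
  rewrite /den cardE -(size_map f); apply: perm_size; apply: uniq_perm.
  - exact: fset_uniq.
  - by rewrite map_inj_uniq ?enum_uniq.
  move=> [u v]; rewrite memH mem_cat mem_axis; apply/orP/mapP => [uvH|].
    have equv : a * u + b * v = d.
      case: uvH => [/mapP[i]|/andP[_ /eqP //]].
      rewrite mem_iota add0n => /ptT[ltx y0 eqd] [-> ->]; nia.
    have [ltu ltv] : u < d.+1 /\ v < d.+1 by split; nia.
    exists (Ordinal ltu, Ordinal ltv) => //.
    by rewrite mem_enum inE /= -equv mulnC [v * b]mulnC.
  case=> -[[u' ltu] [v' ltv]]; rewrite mem_enum inE /= => /eqP def_d.
  case=> -> ->; rewrite !(mulnC _ a) !(mulnC _ b) in def_d.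
  rewrite def_d eqxx andbT.
  have [u0|u0] := posnP u'; first by right.
  have [v0|v0] := posnP v'; first by right; rewrite orbT.
  left; have [i [def_u def_v lti leiT]] := intT _ _ u0 v0 (esym def_d).
  have def_x : x = u' + i * b by lia.
  have ax_d : a * x <= d by rewrite def_x def_d def_v; nia.
  have ltiq : i < q - 1.
    have: a * b * i < a * x by rewrite -mulnA ltn_pmul2l // mulnC.
    by move=> /leq_trans/(_ (leq_trans ax_d le_d)); rewrite ltn_pmul2l // muln_gt0 a_gt0.
  by rewrite def_u def_v; apply: map_f; rewrite mem_iota add0n leiT.
have defT : T = q - 1; last first.
  by rewrite (perm_size eqH) size_cat size_axis_points size_map size_iota defT addnA.
(* Here [v <= a] forces [a u > a b (q - 2)], so [q - 2] further steps [(-b, a)] stay in the interior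
   and the index [q - 2] occurs. *)
have [|u [v [u0 v0 v_le equv]]] := lattice_point_low; first nia.
have [i [def_u def_v lti _]] := intT _ _ u0 v0 equv.
have gt_u : b * (q - 2) < u by nia.
have [||| j [def_u' def_v' ltj leT']] := intT (u - (q - 2) * b) (v + (q - 2) * a).
- by nia.
- by nia.
- by nia.
have lej : q - 2 <= j by nia.
have : q - 2 < T by apply: leT' => //; lia.
lia.
Qed.

End LatticePoints.

(** * Exponents of the monomials divisible by x0 *)

Section AffineCount.

Set Implicit Arguments.
Unset Strict Implicit.

Definition affine_exponents (q a b d : nat) : seq (nat * nat) :=
  [seq p <- [seq (m, k) | m <- index_iota 0 q, k <- index_iota 0 q]
         | a * p.1 + b * p.2 < d].

Lemma mem_affine q a b d p : (p \in affine_exponents q a b d) =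
  [&& a * p.1 + b * p.2 < d, p.1 < q & p.2 < q].
Proof.
case: p => m k; rewrite mem_filter; congr andb.
by apply/allpairsP/andP=> [[[u v] /= []]|[ltm ltk]];
  [rewrite !mem_index_iota => ? ? [-> ->] | exists (m, k); rewrite !mem_index_iota].
Qed.

Lemma uniq_affine q a b d : uniq (affine_exponents q a b d).
Proof.
rewrite filter_uniq // allpairs_uniq ?iota_uniq // => -[u v] [u' v'] _ _.
by [].
Qed.

Lemma sum_ltn q M : \sum_(0 <= m < q) (m < M) = minn q M.
Proof.
elim: q => [|q IHq]; first by rewrite big_geq ?min0n.
by rewrite big_nat_recr //= IHq; lia.
Qed.

Variables (q a b d : nat).
Hypotheses (a_gt0 : 0 < a) (b_gt0 : 0 < b) (d_gt0 : 0 < d) (q_gt1 : 1 < q).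

(** A negative numerator has a negative floor, which the maximum replaces by 0; otherwise integer
    and natural division agree. *)
Lemma ellE : ell q a b d =
  if d - 1 < a * (q - 1) then 0
  else minn (q - 1) ((d - 1 - a * (q - 1)) %/ b).
Proof.
rewrite /ell /ell_int.
case: ltnP => [lt_d|le_d].
  suff : (((d%:Z - 1 - a%:Z * (q%:Z - 1))%R %/ b%:Z)%Z < 0)%R by lia.
  rewrite ltz_divLR; last lia.
  nia.
have -> : (d%:Z - 1 - a%:Z * (q%:Z - 1) = (d - 1 - a * (q - 1))%N%:Z)%R by nia.
rewrite divz_nat; set n := (_ %/ b)%N; lia.
Qed.

(** Count by columns of fixed [k]: each column with [k <= ell] holds [mu_a + 1] exponents, one with
    [ell < k <= mu_b] holds one more than the floor in the sum, and later ones are empty. *)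
Lemma size_affine : size (affine_exponents q a b d) =
  (ell q a b d + 1) * mu_a q a d + mu_b q b d + 1
     + \sum_(ell q a b d + 1 <= y < (mu_b q b d).+1) (d - 1 - b * y) %/ a.
Proof.
(* The guard matters: for [b k >= d] truncated subtraction would still count [m = 0]. *)
pose g k := if b * k < d then minn q ((d - 1 - b * k) %/ a).+1 else 0.
have -> : size (affine_exponents q a b d) = \sum_(0 <= k < q) g k.
  rewrite -sum1_size big_filter big_mkcond big_allpairs exchange_big.
  apply: eq_bigr => k _; rewrite /g; case: ifP => lt_d; last first.
    by rewrite big1 // => m _; case: ifP => //=; lia.
  rewrite -sum_ltn; apply: eq_bigr => m _ /=.
  have -> : (m < ((d - 1 - b * k) %/ a).+1) = (a * m + b * k < d).
    rewrite ltnS leq_divRL //; lia.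
  by case: (_ < d).
have le_bk k : (k <= (d - 1) %/ b) = (b * k < d).
  rewrite leq_divRL //; lia.
have le_mu : ell q a b d <= mu_b q b d.
  rewrite ellE /mu_b; case: ltnP => // le_d.
  have := leq_div2r b (leq_subr (a * (q - 1)) (d - 1)); lia.
have mu_lt : mu_b q b d < q by rewrite /mu_b; lia.
rewrite (big_cat_nat (n := (ell q a b d).+1)) //=; last by lia.
rewrite [X in _ + X](big_cat_nat (n := (mu_b q b d).+1)) //=.
have -> : \sum_((mu_b q b d).+1 <= k < q) g k = 0.
  rewrite big_nat big1 // => k /andP[ltk ltq]; rewrite /g -le_bk.
  by move: ltk; rewrite /mu_b; case: ifP => //; lia.
have -> : \sum_(0 <= k < (ell q a b d).+1) g k =
    \sum_(0 <= k < (ell q a b d).+1) (mu_a q a d).+1.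
  apply: eq_big_nat => k; rewrite ltnS /g /mu_a ellE /=.
  (* Either [ell = 0] and only the column [k = 0] is concerned, or the column is full and
     [mu_a = q - 1]. *)
  case: ltnP => [_|le_d].
    by rewrite leqn0 => /eqP ->; rewrite muln0 d_gt0 subn0; lia.
  rewrite leq_min leq_divRL // => /andP[_ lek].
  have lt_d : b * k < d.
    by rewrite -(prednK d_gt0) ltnS -subn1 mulnC (leq_trans lek) ?leq_subr.
  rewrite lt_d; have : q - 1 <= (d - 1 - b * k) %/ a.
    rewrite leq_divRL //; lia.
  have : q - 1 <= (d - 1) %/ a by rewrite leq_divRL //; lia.
  lia.
have -> : \sum_((ell q a b d).+1 <= k < (mu_b q b d).+1) g k =
    \sum_((ell q a b d).+1 <= k < (mu_b q b d).+1) ((d - 1 - b * k) %/ a + 1).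
  apply: eq_big_nat => k /andP[]; rewrite ltnS /g ellE /mu_b leq_min => gtk /andP[].
  rewrite le_bk => -> lekq.
  (* Past [ell] no column is full, so the minimum with [q] is the other term. *)
  have : (d - 1 - b * k) %/ a < q - 1; last lia.
  rewrite ltn_divLR //; move: gtk; case: (ltnP (d - 1)) => [lt_d _|le_d].
    by rewrite (mulnC _ a) (leq_ltn_trans _ lt_d) ?leq_subr.
  rewrite gtn_min ltnNge lekq /= ltn_divLR // (mulnC k) [X in _ -> _ < X]mulnC.
  have : 0 < a * (q - 1) by rewrite muln_gt0 a_gt0 subn_gt0.
  by move: le_d; set N := a * _; set M := b * k; lia.
rewrite big_split /= !sum_nat_const_nat !(addn1 (ell _ _ _ _)) subn0 muln1 mulnS.
by move: le_mu; set S := \sum_(_ <= _ < _) _; set M := _ * _; lia.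
Qed.

End AffineCount.

(** * Independence *)

Section Independence.

Set Implicit Arguments.
Unset Strict Implicit.
Import GRing.Theory.
Local Open Scope ring_scope.

(** A nonzero polynomial of degree less than [N] over an integral domain has fewer than [N]
    roots. *)
Lemma powers_free (R : idomainType) (N : nat) (c : nat -> R) (s : seq R) :
    uniq s -> (N <= size s)%N ->
    {in s, forall x, \sum_(0 <= i < N) c i * x ^+ i = 0} ->
  forall i, (i < N)%N -> c i = 0.
Proof.
move=> uniq_s leN sum0 i ltiN.
have p0: \poly_(j < N) c j = 0.
  apply: (@roots_geq_poly_eq0 _ _ s) => //; last exact: leq_trans (size_poly _ _) leN.
  by apply/allP=> x /sum0; rewrite big_mkord /root horner_poly => ->.
by have := coef_poly N c i; rewrite p0 coef0 ltiN => <-.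
Qed.

(** For [x != 0] this is Fermat's little theorem; the hypothesis settles [x = 0], where the exponent
    0 gives 1 and all others give 0. *)
Lemma expf_reduce (F : finFieldType) (x : F) m k :
    (m == 0)%N = (m + k * (#|F| - 1) == 0)%N ->
  x ^+ (m + k * (#|F| - 1)) = x ^+ m.
Proof.
move=> eq_m0; have [->|x0] := eqVneq x 0; first by rewrite !expr0n eq_m0.
have x1 : x ^+ (#|F| - 1) = 1.
  apply: (mulfI x0); rewrite mulr1 -exprS -[RHS]expf_card; congr (_ ^+ _).
  by rewrite subn1 prednK // ltnW ?finNzRing_gt1.
by rewrite exprD mulnC exprM x1 expr1n mulr1.
Qed.

(** Positive exponents are reduced into [[1, Q]] rather than [[0, Q - 1]], so that 0 comes only from
    0, as [expf_reduce] demands. *)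
Lemma exponent_reduction Q m : (0 < Q)%N ->
  exists m' k, [/\ m = m' + k * Q, m' <= Q & (m' == 0) = (m == 0)]%N.
Proof.
move=> Q_gt0; case: m => [|m]; first by exists 0%N, 0%N.
exists (m %% Q).+1%N, (m %/ Q)%N; split=> //; last by rewrite ltn_pmod.
by rewrite {1}(divn_eq m Q) addnC addSn.
Qed.

(** The ring is arbitrary because the monomial is evaluated both over [F] and over [K]. *)
Definition monomial_at (R : comNzRingType) (a b d : nat) (x : 'I_3 -> R)
    (p : nat * nat) : R :=
  x 0 ^+ (d - (a * p.1 + b * p.2)) * x 1 ^+ p.1 * x 2 ^+ p.2.

Lemma big_ord3 (R : Type) (idx : R) (op : Monoid.law idx) (f : 'I_3 -> R) :
  \big[op/idx]_(i < 3) f i = op (op (f 0) (f 1)) (f 2).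
Proof.
rewrite !big_ord_recl big_ord0 Monoid.mulm1 Monoid.mulmA.
by congr (op (op (f _) (f _)) (f _)); apply: val_inj.
Qed.

Lemma wmdeg3 a b m : wmdeg a b m = (m 0%R + a * m 1%R + b * m 2%R)%N.
Proof.
rewrite /wmdeg big_ord3 /wt !(tnth_nth 0%N) /= muln1; congr (_ + _ + _)%N.
  by rewrite mulnC.
by rewrite mulnC.
Qed.

Lemma monomial_at_scale (R : comNzRingType) a b d (x y : 'I_3 -> R) lam p :
    (a * p.1 + b * p.2 <= d)%N -> (forall i, y i = lam ^+ wt a b i * x i) ->
  monomial_at a b d y p = lam ^+ d * monomial_at a b d x p.
Proof.
move=> le_d def_y; rewrite /monomial_at !def_y /wt !(tnth_nth 0%N) /=.
rewrite -[in lam ^+ d](subnK le_d) expr1 !exprMn !exprD -!exprM.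
ring.
Qed.

(** * Vanishing of the coefficients: axes, line at infinity, affine plane *)

Section Free.
Variables (F : finFieldType) (a b d x y T : nat) (c : nat * nat -> F).
Hypotheses (a_gt0 : (0 < a)%N) (b_gt0 : (0 < b)%N) (co_ab : coprime a b).
Hypotheses (d_gt0 : (0 < d)%N) (leT : (T <= #|F| - 1)%N).
Hypothesis lineT :
  forall i, (i < T)%N -> [/\ i * b < x, 0 < y & a * x + b * y = d]%N.

Let J := affine_exponents #|F| a b d ++ (line a b x y T ++ axis_points a b d).

Hypothesis sum0 : forall v : 'I_3 -> F, [exists i, v i != 0] ->
  \sum_(p <- J) c p * monomial_at a b d v p = 0.

Lemma mem_exponents p : (p \in J) = [|| p \in affine_exponents #|F| a b d,
  p \in line a b x y T | p \in axis_points a b d].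
Proof. by rewrite mem_cat [X in _ || X]mem_cat. Qed.

Lemma uniq_exponents : uniq J.
Proof.
have uniqH : uniq (line a b x y T ++ axis_points a b d).
  by apply: uniq_line_axis => // i /lineT[].
rewrite cat_uniq uniq_affine uniqH andbT /=.
apply/hasPn=> p; rewrite mem_affine mem_cat mem_axis //.
case/orP=> [/(line_interior lineT)[_ _ ->]|/andP[_ /eqP ->]]; by rewrite ltnn.
Qed.

Lemma coef_unique v p : p \in J -> [exists i, v i != 0] ->
    monomial_at a b d v p != 0 ->
    {in J, forall r, r != p -> c r * monomial_at a b d v r = 0} ->
  c p = 0.
Proof.
move=> Jp v0 vp0 J0; have := sum0 v0.
rewrite (bigD1_seq p) ?uniq_exponents //= big_seq_cond big1 ?addr0.
  by move/eqP; rewrite mulf_eq0 (negPf vp0) orbF => /eqP.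
by move=> r /andP[]; apply: J0.
Qed.

Definition vec3 (u v w : F) (i : 'I_3) : F := tnth [tuple u; v; w] i.

Lemma monomial_vec3 u v w p : monomial_at a b d (vec3 u v w) p =
  u ^+ (d - (a * p.1 + b * p.2)) * v ^+ p.1 * w ^+ p.2.
Proof. by rewrite /monomial_at /vec3 !(tnth_nth 0). Qed.

Lemma affine_at_infinity v w p : p \in affine_exponents #|F| a b d ->
  monomial_at a b d (vec3 0 v w) p = 0.
Proof.
rewrite mem_affine monomial_vec3 => /and3P[ltd _ _].
by rewrite expr0n subn_eq0 leqNgt ltd !mul0r.
Qed.

(** On [x0 = 0] only exponents of weight exactly [d] survive; at [(0, 0, 1)] or [(0, 1, 0)] they
    must moreover lie on one axis, where the weight determines them. *)
Lemma coef_axis p : p \in axis_points a b d -> c p = 0.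
Proof.
move=> pax; have := pax; rewrite mem_axis // => /andP[p0 /eqP eqd].
have Jp : p \in J by rewrite mem_exponents pax !orbT.
have Jle r : r \in J -> r \in affine_exponents #|F| a b d \/
    (a * r.1 + b * r.2 = d)%N.
  rewrite mem_exponents mem_axis //.
  by case/or3P=> [->|/(line_interior lineT)[_ _ ->]|/andP[_ /eqP]]; [left | right | right].
have [p1 | p2] := orP p0.
- apply: (@coef_unique (vec3 0 0 1)) => //.
  + by apply/existsP; exists 2; rewrite /vec3 (tnth_nth 0) oner_eq0.
  + by rewrite monomial_vec3 eqd subnn (eqP p1) !expr0 expr1n !mulr1 oner_eq0.
  move=> r /Jle[/affine_at_infinity->|eqr rp]; first by rewrite mulr0.
  rewrite monomial_vec3 expr0n expr0n; case: (r.1 =P 0%N) => [r1|]; last first.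
    by rewrite mulr0 mul0r mulr0.
  case/eqP: rp; move: eqr; rewrite -eqd (eqP p1) r1.
  case: (r) (p) r1 p1 => [r1 r2] [u v] /= -> /eqP ->.
  by rewrite !muln0 !add0n => /eqP; rewrite eqn_pmul2l // => /eqP ->.
- apply: (@coef_unique (vec3 0 1 0)) => //.
  + by apply/existsP; exists 1; rewrite /vec3 (tnth_nth 0) oner_eq0.
  + by rewrite monomial_vec3 eqd subnn (eqP p2) !expr0 expr1n !mulr1 oner_eq0.
  move=> r /Jle[/affine_at_infinity->|eqr rp]; first by rewrite mulr0.
  rewrite monomial_vec3 [0 ^+ r.2]expr0n; case: (r.2 =P 0%N) => [r2|]; last first.
    by rewrite !mulr0.
  case/eqP: rp; move: eqr; rewrite -eqd (eqP p2) r2.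
  case: (r) (p) r2 p2 => [r1 r2] [u v] /= -> /eqP ->.
  by rewrite !muln0 !addn0 => /eqP; rewrite eqn_pmul2l // => /eqP ->.
Qed.

Lemma coef_line p : p \in line a b x y T -> c p = 0.
Proof.
case/mapP=> i; rewrite mem_iota add0n /= => ltiT ->.
have [[t s] /= ts1] : exists u, (u.1 * a - u.2 * b = 1)%N by exact/coprimeP.
(* By [t a - s b = 1], the monomial of index [i] takes the value [z^(s x + t y) z^i] at
   [(0, z^s, z^t)]; the polynomial left has at most [q - 1] coefficients and vanishes at all [q - 1]
   nonzero [z]. *)
apply: (@powers_free _ T (fun i => c (x - i * b, y + i * a)%N)
          [seq z <- enum F | z != 0]) => //.
- by rewrite filter_uniq ?enum_uniq.
- have -> : size [seq z <- enum F | z != 0] = #|predC1 (0 : F)|.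
    by rewrite cardE [in RHS]/enum_mem !size_filter enumT.
  by rewrite cardC1 -subn1.
move=> z; rewrite mem_filter => /andP[z0 _].
have v0 : [exists i, vec3 0 (z ^+ s) (z ^+ t) i != 0].
  by apply/existsP; exists 1; rewrite /vec3 (tnth_nth 0) expf_neq0.
have := sum0 v0.
rewrite big_cat /= [X in _ + X]big_cat /= [X in X + _]big_seq big1 ?add0r; last first.
  by move=> r /affine_at_infinity->; rewrite mulr0.
rewrite [X in _ + X]big_seq [X in _ + X]big1 ?addr0; last first.
  by move=> r /coef_axis->; rewrite mul0r.
rewrite big_map => sumz; have zx0 : z ^+ (s * x + t * y) != 0 by rewrite expf_neq0.
apply: (mulfI zx0); rewrite [RHS]mulr0 -[RHS]sumz mulr_sumr /index_iota subn0.
rewrite big_seq [RHS]big_seq; apply: eq_bigr => j; rewrite mem_iota add0n.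
move=> ltj; have [ltx y0 eqd] := lineT ltj.
have eqd' : (a * (x - j * b) + b * (y + j * a) = d)%N by nia.
rewrite mulrCA monomial_vec3 /= eqd' subnn mul1r -!exprM -!exprD.
by congr (_ * _ ^+ _); nia.
Qed.

Lemma coef_affine p : p \in affine_exponents #|F| a b d -> c p = 0.
Proof.
(* [g] extends the coefficients by 0 to the full square [[0, q - 1]^2], so that the sum at
   [(1, v, w)] is a polynomial in [v] with coefficients polynomial in [w]. *)
move=> paff; pose g m k := if (a * m + b * k < d)%N then c (m, k) else 0.
have sumg (v w : F) : \sum_(0 <= m < #|F|) (\sum_(0 <= k < #|F|)
    g m k * w ^+ k) * v ^+ m = 0.
  have v0 : [exists i, vec3 1 v w i != 0].
    by apply/existsP; exists 0; rewrite /vec3 (tnth_nth 0) oner_eq0.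
  rewrite -[RHS](sum0 v0) [RHS]big_cat /= [X in _ + X]big_seq.
  rewrite [X in _ + X]big1 ?addr0; last first.
    move=> r; rewrite mem_cat => /orP[/coef_line|/coef_axis] ->; exact: mul0r.
  rewrite /affine_exponents [RHS]big_filter [RHS]big_mkcond [RHS]big_allpairs.
  apply: eq_bigr => m _; rewrite mulr_suml; apply: eq_bigr => k _.
  rewrite monomial_vec3 /g /= expr1n mul1r.
  by case: ifP; rewrite ?mul0r // mulrAC mulrA.
have := paff; case: (p) => m k; rewrite mem_affine /= => /and3P[ltd ltm ltk].
have -> : c (m, k) = g m k by rewrite /g ltd.
have sizeF : (#|F| <= size (enum F))%N by rewrite cardE.
(* Independence of powers serves twice: in [v] for each fixed [w], and in [w] for the resulting
   coefficients. *)
apply: (powers_free (enum_uniq F) sizeF) ltk => w _.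
by apply: (powers_free (c := fun m => \sum_(0 <= k < #|F|) g m k * w ^+ k)
  (enum_uniq F) sizeF _ ltm) => v _; apply: sumg.
Qed.

Lemma coef_eq0 p : p \in J -> c p = 0.
Proof.
by rewrite mem_exponents => /or3P[/coef_affine|/coef_line|/coef_axis].
Qed.

End Free.

End Independence.

(** * The basis of the code *)

Section Dimension.

Import GRing.Theory.
Local Open Scope ring_scope.
Set Implicit Arguments.
Unset Strict Implicit.

Variables (F : finFieldType) (K : closedFieldType) (iota : {rmorphism F -> K}).
Variables (a b n d : nat) (P : 'I_n -> 'rV[F]_3).
Hypotheses (a_gt0 : (0 < a)%N) (b_gt0 : (0 < b)%N) (co_ab : coprime a b).
Hypotheses (d_gt0 : (0 < d)%N) (hP : wreps iota a b P).

(** The orbit of [v] is a rational point, so some representative lies in it; the scalar is only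
    known to lie in [K]. *)
Lemma rep_of_vec (v : 'rV[F]_3) : v != 0 -> exists i, exists lam : K,
  lam != 0 /\ map_mx iota (P i) = wscale a b lam (map_mx iota v).
Proof.
move=> v0; case: hP => _ /(_ (fun y =>
  exists2 lam : K, lam != 0 & y = wscale a b lam (map_mx iota v))).
case.
- by exists (map_mx iota v); rewrite ?map_mx_eq0.
- exists v, 1; rewrite ?oner_eq0 //.
  by apply/rowP=> j; rewrite !mxE expr1n mul1r.
by move=> i [[lam lam0 def_P] _]; exists i, lam.
Qed.

Definition evmon (p : nat * nat) : 'rV[F]_n :=
  \row_i monomial_at a b d (fun j => P i 0 j) p.

(** A relation between codewords speaks only of the chosen representatives; applying the injective
    [iota] and cancelling [lam ^+ d] carries it to every nonzero vector over [F]. *)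
Lemma sum_vanishes (J : seq (nat * nat)) (c : nat * nat -> F) :
    {in J, forall p, a * p.1 + b * p.2 <= d}%N ->
    \sum_(p <- J) c p *: evmon p = 0 ->
  forall v : 'I_3 -> F, [exists i, v i != 0] ->
  \sum_(p <- J) c p * monomial_at a b d v p = 0.
Proof.
move=> leJ sum0 v /existsP[j vj].
have v0 : \row_i v i != 0.
  by apply: contraNneq vj => /rowP/(_ j); rewrite !mxE => ->.
have [i [lam [lam0 /rowP def_P]]] := rep_of_vec v0.
have iota_mon (w : 'I_3 -> F) p :
    iota (monomial_at a b d w p) = monomial_at a b d (iota \o w) p.
  by rewrite /monomial_at !rmorphM !rmorphXn.
apply/eqP; rewrite -(fmorph_eq0 iota) -(mulrI_eq0 _ (mulfI (expf_neq0 d lam0))).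
apply/eqP; transitivity (iota ((\sum_(p <- J) c p *: evmon p) 0 i)); last first.
  by rewrite sum0 mxE rmorph0.
rewrite summxE !rmorph_sum mulr_sumr big_seq [RHS]big_seq.
apply: eq_bigr => p /leJ le_d; rewrite !mxE !(rmorphM iota (c p)) !iota_mon mulrCA.
congr (_ * _); apply/esym/monomial_at_scale => // k.
by have := def_P k; rewrite !mxE.
Qed.

Lemma evY_monomial (m : 'X_{1..3}) : wmdeg a b m = d ->
  evY P 'X_[m] = evmon (m 1, m 2).
Proof.
rewrite wmdeg3 => def_d; apply/rowP=> i; rewrite !mxE mevalX big_ord3.
by rewrite /monomial_at /= -{1}def_d -addnA addnK.
Qed.

Lemma codeword_ev p : (a * p.1 + b * p.2 <= d)%N -> codeword a b d P (evmon p).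
Proof.
move=> le_d; pose s := [:: d - (a * p.1 + b * p.2); p.1; p.2]%N.
pose m := [multinom nth 0%N s i | i < 3].
have def_d : wmdeg a b m = d.
  by rewrite wmdeg3 !mnmE /= -addnA subnK.
exists 'X_[m]; first by rewrite dhomogX; apply/eqP.
by rewrite evY_monomial // !mnmE /=; case: (p).
Qed.

(** * Reduction of monomials, spanning and freeness *)

Variables x y T : nat.
Hypothesis leT : (T <= #|F| - 1)%N.
Hypothesis lineT :
  forall i, (i < T)%N -> [/\ i * b < x, 0 < y & a * x + b * y = d]%N.
Hypothesis line_full : forall x0 y0, (0 < x0)%N -> (0 < y0)%N ->
  (a * x0 + b * y0 = d)%N -> exists i, [/\ x0 = x - i * b, y0 = y + i * a,
    i * b < x & forall j, j < #|F| - 1 -> j <= i -> j < T]%N.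

Let J := affine_exponents #|F| a b d ++ (line a b x y T ++ axis_points a b d).

Lemma basis_weight : {in J, forall p, a * p.1 + b * p.2 <= d}%N.
Proof.
move=> p; rewrite mem_exponents mem_axis // mem_affine.
case/or3P=> [/and3P[/ltnW //]|/(line_interior lineT)[_ _ ->] //|].
by case/andP=> _ /eqP ->.
Qed.

Lemma monomial_reduction p : (a * p.1 + b * p.2 <= d)%N ->
  exists2 r, r \in J & evmon p = evmon r.
Proof.
have Q_gt0 : (0 < #|F| - 1)%N by rewrite subn_gt0 finNzRing_gt1.
case: p => u v /=; rewrite leq_eqVlt => /predU1P[eqd|ltd]; last first.
  (* Lowering these exponents by multiples of [q - 1] keeps the weight below [d], while the exponent
     of [x0], already positive, grows by a multiple of [q - 1]. *)
  have [u' [k [def_u leu u0]]] := exponent_reduction u Q_gt0.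
  have [v' [l [def_v lev v0]]] := exponent_reduction v Q_gt0.
  have le_uv : (a * u' + b * v' <= a * u + b * v)%N by rewrite def_u def_v; nia.
  have ltd' := leq_ltn_trans le_uv ltd.
  exists (u', v').
    have ltF m : (m <= #|F| - 1 -> m < #|F|)%N.
      by rewrite subn1 -ltnS prednK // ltnW ?finNzRing_gt1.
    by rewrite mem_exponents mem_affine /= ltd' !ltF.
  apply/rowP=> i; rewrite !mxE /monomial_at /=.
  have def_e : (d - (a * u' + b * v') =
      d - (a * u + b * v) + (a * k + b * l) * (#|F| - 1))%N.
    by rewrite def_u def_v in ltd *; nia.
  rewrite def_e expf_reduce; last by rewrite -def_e; lia.
  by rewrite def_u def_v !expf_reduce -?def_u -?def_v.
have [u0|u0] := posnP u; first by
  exists (u, v); rewrite // mem_exponents mem_axis //= u0 eqxx /= -eqd u0 eqxx !orbT.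
have [v0|v0] := posnP v; first by
  exists (u, v); rewrite // mem_exponents mem_axis //= v0 eqxx /= -eqd v0 eqxx !orbT.
have [i [def_u def_v lti lei]] := line_full u0 v0 eqd.
(* Reducing the index modulo [q - 1] changes both exponents by multiples of [q - 1] and keeps them
   positive; [j <= i] and [j < q - 1] place the new point in the retained segment. *)
pose j := (i %% (#|F| - 1))%N; pose k := (i %/ (#|F| - 1))%N.
have def_i : (i = j + k * (#|F| - 1))%N by rewrite addnC -divn_eq.
have ltj : (j < T)%N by rewrite lei ?ltn_pmod ?leq_mod.
have jline : ((x - j * b, y + j * a) \in line a b x y T)%N.
  by apply: map_f; rewrite mem_iota add0n.
exists (x - j * b, y + j * a)%N; first by rewrite mem_exponents jline orbT.
have [_ _ /= eqd'] := line_interior lineT jline.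
apply/rowP=> h; rewrite !mxE /monomial_at /= eqd' eqd.
have -> : (x - j * b = u + (k * b) * (#|F| - 1))%N.
  by rewrite def_u def_i in lti *; nia.
have def_v' : (v = y + j * a + (k * a) * (#|F| - 1))%N.
  by rewrite def_v def_i; nia.
have [_ y0 _] := lineT ltj.
by rewrite def_v' !expf_reduce // !addn_eq0 ?(gtn_eqF y0) ?(gtn_eqF u0).
Qed.

Lemma code_eq_span : wprm_code a b d P = <<[seq evmon p | p <- J]>>%VS.
Proof.
apply/eqP; rewrite eqEsubv; apply/andP; split; last first.
  apply/span_subvP=> v /mapP[p Jp ->].
  by apply/mem_wprm_code/codeword_ev/basis_weight.
apply/subvP=> v /mem_wprm_code[f /dhomogP hf ->].
have -> : evY P f = \sum_(m <- msupp f) f@_m *: evY P 'X_[m].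
  apply/rowP=> i; rewrite mxE summxE {1}(mpolyE f) raddf_sum /=.
  by apply: eq_bigr => m _; rewrite !mxE mevalZ.
rewrite big_seq; apply: rpred_sum => m /hf def_d; apply: rpredZ.
rewrite evY_monomial //.
have [|r Jr ->] := @monomial_reduction (m 1, m 2).
  by rewrite /= -[leqRHS]def_d [leqRHS]wmdeg3 -addnA leq_addl.
by apply/memv_span/map_f.
Qed.

Lemma free_ev : free [seq evmon p | p <- J].
Proof.
have uJ : uniq J by apply: uniq_exponents.
apply/(@freeP _ _ _ (map_tuple evmon (in_tuple J))) => k sum0 i.
(* Coefficients indexed by positions in [J] become a function on exponents, with default 0 off
   [J]. *)
pose c p := oapp k 0 (insub (index p J)).
have cE (j : 'I_(size J)) : c (nth (0, 0)%N J j) = k j.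
  by rewrite /c index_uniq // valK.
rewrite -cE; apply: (coef_eq0 a_gt0 b_gt0 co_ab d_gt0 leT lineT); last first.
  exact: mem_nth.
apply: sum_vanishes; first exact: basis_weight.
rewrite (big_nth (0, 0)%N) big_mkord -[RHS]sum0; apply: eq_bigr => j _.
by rewrite cE /= (nth_map (0, 0)%N).
Qed.

Lemma dim_code : \dim (wprm_code a b d P) = size J.
Proof. by rewrite code_eq_span (eqP free_ev) size_map. Qed.

End Dimension.

(** * The dimension formula from the size of the basis *)

Theorem theorem2p13 (q : nat) (F : finFieldType) (hq : #|F| = q)
  (K : closedFieldType) (iota : {rmorphism F -> K})
  (Kalg : forall x : K, algebraicOver iota x)
  (a b : nat) (a_gt0 : 1 <= a) (le_ab : a <= b) (co_ab : coprime a b)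
  (n : nat) (P : 'I_n -> 'rV[F]_3) (hP : wreps iota a b P)
  (d : nat) (d_gt0 : 1 <= d) :
  (\dim (wprm_code a b d P) =
     (ell q a b d + 1) * mu_a q a d + mu_b q b d + 1
     + \sum_(ell q a b d + 1 <= y < (mu_b q b d).+1) (d - 1 - b * y) %/ a
     + #|` H q a b d|)
  /\
  (#|` H q a b d| =
     if d <= a * b * (q - 1) then den a b d
     else q - 1 + (a %| d) + (b %| d)).
Proof.
have b_gt0 : 0 < b := leq_trans a_gt0 le_ab.
have q_gt1 : 1 < q by rewrite -hq finNzRing_gt1.
split; last exact: card_H.
have [x [y [T [leT lineT line_full eqH]]]] :=
  H_decomposition a_gt0 b_gt0 d_gt0 co_ab q_gt1.
(* The right-hand side becomes the length of the concatenated exponent lists, the index set of the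
   basis. *)
rewrite -size_affine // (perm_size eqH) -size_cat; subst q.
exact: dim_code hP _ _ _ leT lineT line_full.
Qed.
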